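(* Let $\mathcal{C}$ be a homological category, and let $(\mathbf{R},\mu)$ be an idempotent radical on $\mathcal{C}$. Let $\mathcal{X}$ be the full reflective subcategory of objects $X$ of $\mathcal{C}$ with $\mathbf{R}(X)=0$, with inclusion $\mathbf{H}:\mathcal{X}\to\mathcal{C}$, reflector $\mathbf{I}:\mathcal{C}\to\mathcal{X}$, $\mathbf{I}(C)=C/\mathbf{R}(C)$, and unit $\eta$. Then the pair of morphism classes $$\bigl(\mathbf{I}^{-1}(RegEpi\;\mathcal{X}),\ (\mathbf{H}(Mono\;\mathcal{X}))^{\uparrow\downarrow}\bigr)$$ is a factorization system on $\mathcal{C}$. Moreover: (1) $\mathbf{I}^{-1}(RegEpi\;\mathcal{X})$ is the class of morphisms $f:C\to C'$ of $\mathcal{C}$ such that the composition $\eta_{C'}f$ is a regular epimorphism; if the image of $f:C\to C'$ is a normal subobject of $C'$ (in particular, for every morphism $f$ if $\mathcal{C}$ is abelian), then $f\in\mathbf{I}^{-1}(RegEpi\;\mathcal{X})$ if and only if $Im\,f+\mathbf{R}(C')=C'$. (2) For a morphism $m:C\to C'$ of $\mathcal{C}$ the following are equivalent: (i) $m\in(\mathbf{H}(Mono\;\mathcal{X}))^{\uparrow\downarrow}$; (ii) $m$ is a monomorphism and $\mathbf{R}(C')\subseteq C$ as subobjects of $C'$; (iii) $m$ is a monomorphism such that, if $D$ is a subobject of $C'$ for which the composition of the inclusion $C\cap D\rightarrowtail D$ with the morphism $\eta_D$ is a regular epimorphism, then $D\subseteq C$.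
   Context: A category is homological if it is pointed, regular and protomodular. A normal monomorphism is a monomorphism that is a kernel; in a homological category every normal monomorphism $C\rightarrowtail C'$ has a cokernel, whose codomain is denoted $C'/C$. A radical on a homological category $\mathcal{C}$ is a pair $(\mathbf{R},\mu)$ (for short, $\mathbf{R}$), where $\mathbf{R}$ is an endofunctor of $\mathcal{C}$ and $\mu:\mathbf{R}\to 1_{\mathcal{C}}$ is a natural transformation such that, for every object $C$, $\mu_C:\mathbf{R}(C)\to C$ is a normal monomorphism and $\mathbf{R}(C/\mathbf{R}(C))=0$. The radical is idempotent if the morphism $\mathbf{R}(\mu_C)\,(=\mu_{\mathbf{R}(C)})$ is an isomorphism for every object $C$. The full subcategory $\mathcal{X}$ of objects $X$ with $\mathbf{R}(X)=0$ is reflective in $\mathcal{C}$; the reflector is $\mathbf{I}(C)=C/\mathbf{R}(C)$, the unit $\eta_C:C\to C/\mathbf{R}(C)$ is the cokernel of $\mu_C$, and $\mathbf{H}$ is the inclusion functor. $RegEpi\;\mathcal{A}$ and $Mono\;\mathcal{A}$ denote the classes of regular epimorphisms and of monomorphisms of a category $\mathcal{A}$. For a class $\mathbb{E}$ of morphisms of $\mathcal{X}$, $\mathbf{I}^{-1}(\mathbb{E})$ is the class of morphisms $f$ of $\mathcal{C}$ with $\mathbf{I}(f)\in\mathbb{E}$. For morphisms $e:A\to B$ and $m:C\to D$, write $e\downarrow m$ (equivalently $m\uparrow e$) if for all $\alpha:A\to C$, $\beta:B\to D$ with $\beta e=m\alpha$ there is a unique $\delta:B\to C$ with $m\delta=\beta$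 and $\delta e=\alpha$. For a morphism class $\mathbb{N}$, $\mathbb{N}^{\uparrow}$ is the class of all $f$ with $f\downarrow n$ for all $n\in\mathbb{N}$, and $\mathbb{N}^{\downarrow}$ is the class of all $f$ with $n\downarrow f$ for all $n\in\mathbb{N}$; $\mathbb{N}^{\uparrow\downarrow}=(\mathbb{N}^{\uparrow})^{\downarrow}$. A factorization system on a category is a pair of morphism classes $(\mathbb{E},\mathbb{M})$ such that both classes are closed under composition with isomorphisms, every morphism $f$ can be written $f=me$ with $e\in\mathbb{E}$, $m\in\mathbb{M}$, and $e\downarrow m$ for all $e\in\mathbb{E}$, $m\in\mathbb{M}$. The image $Im\,f$ of $f$ is the subobject given by the monomorphism in the (regular epimorphism, monomorphism)-factorization of $f$. For normal subobjects $H,K$ of an object $C'$, $H+K$ denotes their supremum in the partially ordered class of subobjects of $C'$ (it exists in any homological category). $C\cap D$ is the intersection (pullback) of subobjects. $\mathbf{R}(C')\subseteq C$ means that $\mu_{C'}$ factors through $m$. *)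

(* Defs.v *)
From Stdlib Require Import ClassicalEpsilon.

Set Implicit Arguments.
Unset Strict Implicit.
Unset Printing Implicit Defensive.

Declare Scope cat_scope.
Local Open Scope cat_scope.

Record Category : Type := MkCategory {
  Obj :> Type;
  Hom : Obj -> Obj -> Type;
  idm : forall A : Obj, Hom A A;
  comp : forall A B D : Obj, Hom B D -> Hom A B -> Hom A D;
  comp_idl : forall (A B : Obj) (f : Hom A B), comp (idm B) f = f;
  comp_idr : forall (A B : Obj) (f : Hom A B), comp f (idm A) = f;
  comp_assoc : forall (A B D E : Obj) (h : Hom D E) (g : Hom B D) (f : Hom A B),
    comp h (comp g f) = comp (comp h g) f
}.

Arguments Hom {c} A B.
Arguments idm {c} A.
Arguments comp {c A B D} g f : rename.

Notation "g 'o' f" := (comp g f) (at level 40, left associativity) : cat_scope.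

Record Functor (C D : Category) : Type := MkFunctor {
  fobj :> C -> D;
  fmap : forall A B : C, Hom A B -> Hom (fobj A) (fobj B);
  fmap_id : forall A : C, fmap (idm A) = idm (fobj A);
  fmap_comp : forall (A B E : C) (g : Hom B E) (f : Hom A B),
    fmap (g o f) = fmap g o fmap f
}.

Arguments fmap {C D} F {A B} f : rename.

Definition id_functor (C : Category) : Functor C C :=
  @MkFunctor C C (fun A => A) (fun _ _ f => f)
    (fun _ => eq_refl) (fun _ _ _ _ _ => eq_refl).

Definition comp_functor (C D E : Category) (G : Functor D E) (F : Functor C D) :
  Functor C E.
Proof.
refine (@MkFunctor C E (fun A => G (F A)) (fun A B f => fmap G (fmap F f)) _ _).
- intro A. rewrite (fmap_id F). apply (fmap_id G).
- intros A B K g f. rewrite (fmap_comp F). apply (fmap_comp G).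
Defined.

Record NatTrans (C D : Category) (F G : Functor C D) : Type := MkNatTrans {
  nt_app :> forall A : C, Hom (F A) (G A);
  nt_nat : forall (A B : C) (f : Hom A B),
    nt_app B o fmap F f = fmap G f o nt_app A
}.

Definition full_subcategory (C : Category) (P : C -> Prop) : Category :=
  @MkCategory {A : C | P A}
    (fun X Y => Hom (proj1_sig X) (proj1_sig Y))
    (fun X => idm (proj1_sig X))
    (fun X Y Z g f => g o f)
    (fun X Y f => comp_idl f)
    (fun X Y f => comp_idr f)
    (fun X Y Z W h g f => comp_assoc h g f).

Definition inclusion (C : Category) (P : C -> Prop) :
  Functor (full_subcategory P) C :=
  @MkFunctor (full_subcategory P) C (fun X => proj1_sig X) (fun X Y f => f)
    (fun _ => eq_refl) (fun _ _ _ _ _ => eq_refl).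

Definition Iso (C : Category) (A B : C) (f : Hom A B) : Prop :=
  exists g : Hom B A, g o f = idm A /\ f o g = idm B.

Definition Mono (C : Category) (A B : C) (f : Hom A B) : Prop :=
  forall (T : C) (u v : Hom T A), f o u = f o v -> u = v.

Definition Epi (C : Category) (A B : C) (f : Hom A B) : Prop :=
  forall (T : C) (u v : Hom B T), u o f = v o f -> u = v.

Definition IsCoequalizer (C : Category) (A B Q : C) (f g : Hom A B) (q : Hom B Q) :
  Prop :=
  q o f = q o g /\
  forall (T : C) (t : Hom B T), t o f = t o g -> exists! h : Hom Q T, h o q = t.

Definition RegEpi (C : Category) (A B : C) (q : Hom A B) : Prop :=
  exists (K : C) (f g : Hom K A), IsCoequalizer f g q.

Definition IsPullback (C : Category) (A B D P : C)
    (f : Hom A D) (g : Hom B D) (p : Hom P A) (q : Hom P B) : Prop :=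
  f o p = g o q /\
  forall (T : C) (u : Hom T A) (v : Hom T B), f o u = g o v ->
    exists! h : Hom T P, p o h = u /\ q o h = v.

Definition IsTerminal (C : Category) (T : C) : Prop :=
  forall A : C, exists! f : Hom A T, True.

Definition IsInitial (C : Category) (I : C) : Prop :=
  forall A : C, exists! f : Hom I A, True.

Definition IsZero (C : Category) (Z : C) : Prop := IsInitial Z /\ IsTerminal Z.

Definition Pointed (C : Category) : Prop := exists Z : C, IsZero Z.

Definition FinitelyComplete (C : Category) : Prop :=
  (exists T : C, IsTerminal T) /\
  forall (A B D : C) (f : Hom A D) (g : Hom B D),
    exists (P : C) (p : Hom P A) (q : Hom P B), IsPullback f g p q.

Definition Regular (C : Category) : Prop :=
  FinitelyComplete C /\
  (forall (A B K : C) (f : Hom A B) (p q : Hom K A), IsPullback f f p q ->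
     exists (Q : C) (e : Hom A Q), IsCoequalizer p q e) /\
  (forall (A B D P : C) (f : Hom A D) (g : Hom B D) (p : Hom P A) (q : Hom P B),
     IsPullback f g p q -> RegEpi f -> RegEpi q).

(* The change-of-base functors of the fibration of points reflect isomorphisms:
   (p, s) and (p', s') are split epimorphisms over B, h is a morphism between
   them, and k is the morphism of pullbacks along v induced by h. *)
Definition Protomodular (C : Category) : Prop :=
  forall (A A' B E P P' : C)
         (p : Hom A B) (s : Hom B A) (p' : Hom A' B) (s' : Hom B A')
         (h : Hom A A') (v : Hom E B)
         (a : Hom P A) (b : Hom P E) (a' : Hom P' A') (b' : Hom P' E)
         (k : Hom P P'),
    p o s = idm B -> p' o s' = idm B -> p' o h = p -> h o s = s' ->
    IsPullback p v a b -> IsPullback p' v a' b' ->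
    a' o k = h o a -> b' o k = b ->
    Iso k -> Iso h.

Definition Homological (C : Category) : Prop :=
  Pointed C /\ Regular C /\ Protomodular C.

Definition ZeroMor (C : Category) (A B : C) (f : Hom A B) : Prop :=
  exists (Z : C) (g : Hom A Z) (h : Hom Z B), IsZero Z /\ f = h o g.

Definition IsKernel (C : Category) (K A B : C) (f : Hom A B) (k : Hom K A) : Prop :=
  ZeroMor (f o k) /\
  forall (T : C) (t : Hom T A), ZeroMor (f o t) -> exists! h : Hom T K, k o h = t.

Definition IsCokernel (C : Category) (A B Q : C) (f : Hom A B) (q : Hom B Q) : Prop :=
  ZeroMor (q o f) /\
  forall (T : C) (t : Hom B T), ZeroMor (t o f) -> exists! h : Hom Q T, h o q = t.

Definition NormalMono (C : Category) (K A : C) (k : Hom K A) : Prop :=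
  Mono k /\ exists (B : C) (f : Hom A B), IsKernel f k.

Definition IsProduct (C : Category) (A B P : C) (p : Hom P A) (q : Hom P B) : Prop :=
  forall (T : C) (u : Hom T A) (v : Hom T B),
    exists! h : Hom T P, p o h = u /\ q o h = v.

Definition IsCoproduct (C : Category) (A B S : C) (i : Hom A S) (j : Hom B S) : Prop :=
  forall (T : C) (u : Hom A T) (v : Hom B T),
    exists! h : Hom S T, h o i = u /\ h o j = v.

(* The Freyd--Borceux definition; the additive structure is not part of the data. *)
Definition Abelian (C : Category) : Prop :=
  Pointed C /\
  (forall A B : C, exists (P : C) (p : Hom P A) (q : Hom P B), IsProduct p q) /\
  (forall A B : C, exists (S : C) (i : Hom A S) (j : Hom B S), IsCoproduct i j) /\
  (forall (A B : C) (f : Hom A B), exists (K : C) (k : Hom K A), IsKernel f k) /\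
  (forall (A B : C) (f : Hom A B), exists (Q : C) (q : Hom B Q), IsCokernel f q) /\
  (forall (A B : C) (f : Hom A B), Mono f -> exists (D : C) (g : Hom B D), IsKernel g f) /\
  (forall (A B : C) (f : Hom A B), Epi f -> exists (D : C) (g : Hom D A), IsCokernel g f).

(* [SubLe m n]: for monomorphisms m, n with the same codomain, m <= n as
   subobjects. *)
Definition SubLe (C : Category) (A B D : C) (m : Hom A D) (n : Hom B D) : Prop :=
  exists g : Hom A B, n o g = m.

(* [IsSup h k j]: the subobject j is the supremum of h and k, i.e. j = h + k. *)
Definition IsSup (C : Category) (H K J D : C)
    (h : Hom H D) (k : Hom K D) (j : Hom J D) : Prop :=
  Mono j /\ SubLe h j /\ SubLe k j /\
  forall (L : C) (l : Hom L D), Mono l -> SubLe h l -> SubLe k l -> SubLe j l.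

(* [IsImage f m]: the monomorphism m represents the subobject Im f. *)
Definition IsImage (C : Category) (A B M : C) (f : Hom A B) (m : Hom M B) : Prop :=
  Mono m /\ exists e : Hom A M, RegEpi e /\ f = m o e.

Definition MorClass (C : Category) : Type := forall A B : C, Hom A B -> Prop.

Definition SameClass (C : Category) (N N' : MorClass C) : Prop :=
  forall (A B : C) (f : Hom A B), N A B f <-> N' A B f.

Inductive image_class (C D : Category) (F : Functor C D) (N : MorClass C) :
    MorClass D :=
  | image_class_intro : forall (A B : C) (f : Hom A B),
      N A B f -> image_class F N (fmap F f).

Definition preimage_class (C D : Category) (F : Functor C D) (N : MorClass D) :
    MorClass C :=
  fun A B f => N (F A) (F B) (fmap F f).

Definition Orth (C : Category) (A B D E : C) (e : Hom A B) (m : Hom D E) : Prop :=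
  forall (alpha : Hom A D) (beta : Hom B E), beta o e = m o alpha ->
    exists! delta : Hom B D, m o delta = beta /\ delta o e = alpha.

Definition up (C : Category) (N : MorClass C) : MorClass C :=
  fun A B f => forall (D E : C) (n : Hom D E), N D E n -> Orth f n.

Definition down (C : Category) (N : MorClass C) : MorClass C :=
  fun A B f => forall (D E : C) (n : Hom D E), N D E n -> Orth n f.

Definition ClosedUnderIso (C : Category) (N : MorClass C) : Prop :=
  (forall (A B D : C) (f : Hom A B) (i : Hom B D), N A B f -> Iso i -> N A D (i o f)) /\
  (forall (A B D : C) (i : Hom A B) (f : Hom B D), Iso i -> N B D f -> N A D (f o i)).

Definition FactorizationSystem (C : Category) (E M : MorClass C) : Prop :=
  ClosedUnderIso E /\ ClosedUnderIso M /\
  (forall (A B : C) (f : Hom A B),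
     exists (D : C) (e : Hom A D) (m : Hom D B), E A D e /\ M D B m /\ f = m o e) /\
  (forall (A B D F : C) (e : Hom A B) (m : Hom D F), E A B e -> M D F m -> Orth e m).

(* In [rad_quotient], Q ranges over all representatives of A / R(A). *)
Record Radical (C : Category) : Type := MkRadical {
  rad :> Functor C C;
  rad_mu : NatTrans rad (id_functor C);
  rad_normal : forall A : C, NormalMono (rad_mu A);
  rad_quotient : forall (A Q : C) (q : Hom A Q),
    IsCokernel (rad_mu A) q -> IsZero (rad Q)
}.

Definition mu (C : Category) (R : Radical C) (A : C) : Hom (R A) A := rad_mu R A.

Definition Idempotent (C : Category) (R : Radical C) : Prop :=
  forall A : C, Iso (fmap R (mu R A)).

Definition rad_sub (C : Category) (R : Radical C) : Category :=
  full_subcategory (fun A : C => IsZero (R A)).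

Definition rad_incl (C : Category) (R : Radical C) : Functor (rad_sub R) C :=
  inclusion (fun A : C => IsZero (R A)).

(* The reflector A |-> A / R(A) for a choice of the quotients; see
   [reflector_exists] and [reflector_universal] below. *)
Record Reflector (C : Category) (R : Radical C) : Type := MkReflector {
  reflector :> Functor C (rad_sub R);
  reflector_unit : NatTrans (id_functor C) (comp_functor (rad_incl R) reflector);
  reflector_cokernel : forall A : C, IsCokernel (mu R A) (reflector_unit A)
}.

Definition eta (C : Category) (R : Radical C) (I : Reflector R) (A : C) :
  Hom A (rad_incl R (I A)) := reflector_unit I A.

Lemma zero_comp_l (C : Category) (A B D : C) (g : Hom B D) (f : Hom A B) :
  ZeroMor f -> ZeroMor (g o f).
Proof.
intros [Z [u [v [hZ ->]]]]. exists Z, u, (g o v). split; [exact hZ|].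
apply comp_assoc.
Qed.

Lemma zero_comp_r (C : Category) (A B D : C) (g : Hom B D) (f : Hom A B) :
  ZeroMor g -> ZeroMor (g o f).
Proof.
intros [Z [u [v [hZ ->]]]]. exists Z, (u o f), v. split; [exact hZ|].
symmetry; apply comp_assoc.
Qed.

Lemma initial_eq (C : Category) (Z A : C) (u v : Hom Z A) : IsInitial Z -> u = v.
Proof. intros h. destruct (h A) as [w [_ hw]]. rewrite <- (hw u I). apply hw; exact I. Qed.

Lemma terminal_eq (C : Category) (Z A : C) (u v : Hom A Z) : IsTerminal Z -> u = v.
Proof. intros h. destruct (h A) as [w [_ hw]]. rewrite <- (hw u I). apply hw; exact I. Qed.

Lemma zero_eq (C : Category) (A B : C) (f g : Hom A B) :
  ZeroMor f -> ZeroMor g -> f = g.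
Proof.
intros [Z [u [v [hZ ->]]]] [Z' [u' [v' [hZ' ->]]]].
destruct (proj1 hZ Z') as [w _].
rewrite (initial_eq v (v' o w) (proj1 hZ)), <- comp_assoc.
now rewrite (terminal_eq (w o u) u' (proj2 hZ')).
Qed.

Lemma mono_zero (C : Category) (A B D : C) (m : Hom B D) (f : Hom A B) :
  Mono m -> ZeroMor (m o f) -> ZeroMor f.
Proof.
intros hm h. destruct h as [Z [u [v [hZ e]]]].
destruct (proj1 hZ B) as [w _].
exists Z, u, w. split; [exact hZ|]. apply hm. rewrite e, comp_assoc.
now rewrite (initial_eq v (m o w) (proj1 hZ)).
Qed.

Lemma regepi_epi (C : Category) (A B : C) (f : Hom A B) : RegEpi f -> Epi f.
Proof.
intros [K [a [b [hab hu]]]] T u v huv.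
destruct (hu T (v o f)) as [w [_ hw]].
{ now rewrite <- !comp_assoc, hab. }
now rewrite <- (hw u huv), <- (hw v eq_refl).
Qed.

Lemma pullback_eq (C : Category) (A B D P : C)
    (f : Hom A D) (g : Hom B D) (p : Hom P A) (q : Hom P B) (T : C) (u v : Hom T P) :
  IsPullback f g p q -> p o u = p o v -> q o u = q o v -> u = v.
Proof.
intros [hc hu] h1 h2.
destruct (hu T (p o v) (q o v)) as [w [_ hw]].
{ now rewrite !comp_assoc, hc. }
now rewrite <- (hw u (conj h1 h2)), <- (hw v (conj eq_refl eq_refl)).
Qed.

Lemma image_exists (C : Category) (hC : Regular C) (A B : C) (f : Hom A B) :
  exists (M : C) (m : Hom M B), IsImage f m.
Proof.
destruct hC as [[_ hpb] [hcoeq hstab]].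
destruct (hpb _ _ _ f f) as [K [p [q hK]]].
destruct (hcoeq _ _ _ _ _ _ hK) as [M [e he]].
destruct (proj2 he _ f (proj1 hK)) as [m [hm _]].
assert (hre : RegEpi e) by (exists K, p, q; exact he).
exists M, m. split; [|exists e; split; [exact hre|now symmetry]].
intros T u v huv.
destruct (hpb _ _ _ e u) as [T1 [a1 [t1 h1]]].
destruct (hpb _ _ _ e (v o t1)) as [T2 [a2 [t2 h2]]].
apply (regepi_epi (hstab _ _ _ _ _ _ _ _ h1 hre)).
apply (regepi_epi (hstab _ _ _ _ _ _ _ _ h2 hre)).
rewrite <- (proj1 h2), <- (proj1 h1), <- comp_assoc.
destruct (proj2 hK _ (a1 o t2) a2) as [w [[hw1 hw2] _]].
{ rewrite <- hm, <- !comp_assoc, (proj1 h2), (comp_assoc e a1 t2), (proj1 h1).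
  now rewrite !comp_assoc, huv. }
now rewrite <- hw1, <- hw2, !comp_assoc, (proj1 he).
Qed.

Lemma equalizer_exists (C : Category) (hC : FinitelyComplete C) (A B : C)
    (f g : Hom A B) :
  exists (L : C) (i : Hom L A), f o i = g o i /\
    forall (T : C) (t : Hom T A), f o t = g o t -> exists! h : Hom T L, i o h = t.
Proof.
destruct hC as [[T hT] hpb].
destruct (hT B) as [b _].
destruct (hpb _ _ _ b b) as [P [p1 [p2 hP]]].
assert (pair : forall X (u v : Hom X B), exists w, p1 o w = u /\ p2 o w = v).
{ intros X u v. destruct (proj2 hP X u v (terminal_eq _ _ hT)) as [w [hw _]]. now exists w. }
destruct (pair _ f g) as [fg [hf hg]].
destruct (pair _ (idm B) (idm B)) as [d [hd1 hd2]].
destruct (hpb _ _ _ fg d) as [L [i [j hL]]].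
assert (hfi : f o i = j).
{ rewrite <- hf, <- comp_assoc, (proj1 hL), comp_assoc, hd1. apply comp_idl. }
assert (hgi : g o i = j).
{ rewrite <- hg, <- comp_assoc, (proj1 hL), comp_assoc, hd2. apply comp_idl. }
exists L, i. split; [congruence|].
intros X t ht.
destruct (proj2 hL X t (f o t)) as [h [[hh1 hh2] hh3]].
{ apply (pullback_eq hP).
  - now rewrite !comp_assoc, hf, hd1, comp_idl.
  - now rewrite !comp_assoc, hg, hd2, comp_idl. }
exists h. split; [exact hh1|]. intros h' hh'. apply hh3. split; [exact hh'|].
now rewrite <- hfi, <- comp_assoc, hh'.
Qed.

Lemma regepi_cokernel (C : Category) (hC : Homological C) (K A M : C)
    (e : Hom A M) (k : Hom K A) :
  RegEpi e -> IsKernel e k -> IsCokernel k e.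
Proof.
destruct hC as [[Z hZ] [[hfc _] hproto]].
intros [X [x [y [hxy hcoeq]]]] [hek hker].
split; [exact hek|]. intros B g hgk.
apply hcoeq.
destruct (proj2 hfc _ _ _ e e) as [E [p [q hE]]].
destruct (proj2 hE _ _ _ hxy) as [w [[<- <-] _]].
cut (g o p = g o q).
{ intros h. now rewrite !comp_assoc, h. }
destruct (equalizer_exists hfc (g o p) (g o q)) as [L [i [hi hL]]].
destruct (proj2 hE _ (idm A) (idm A) eq_refl) as [s [[hs1 hs2] _]].
destruct (hL _ s) as [s' [hs' _]].
{ now rewrite <- !comp_assoc, hs1, hs2. }
destruct (proj1 hZ A) as [v _].
destruct (proj2 hfc _ _ _ (p o i) v) as [P [a [b hP]]].
destruct (proj2 hfc _ _ _ p v) as [P' [a' [b' hP']]].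
destruct (proj2 hP' _ (i o a) b) as [c [[hc1 hc2] _]].
{ rewrite comp_assoc. exact (proj1 hP). }
assert (hpz : ZeroMor (p o a')).
{ rewrite (proj1 hP'). exists Z, b', v. now split. }
assert (hgz : g o p o a' = g o q o a').
{ apply zero_eq.
  - rewrite <- comp_assoc. now apply zero_comp_l.
  - destruct (hker _ (q o a')) as [r [hr _]].
    { rewrite comp_assoc, <- (proj1 hE), <- comp_assoc. now apply zero_comp_l. }
    rewrite <- comp_assoc, <- hr, comp_assoc. now apply zero_comp_r. }
destruct (hL _ a' hgz) as [l [hl _]].
destruct (proj2 hP _ l b') as [d [[hd1 hd2] _]].
{ rewrite <- comp_assoc, hl. exact (proj1 hP'). }
assert (himono : Mono i).
{ intros T t1 t2 ht. destruct (hL _ (i o t2)) as [t [_ htu]].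
  { now rewrite !comp_assoc, hi. }
  now rewrite <- (htu t1 ht), <- (htu t2 eq_refl). }
assert (hiso : Iso i).
{ apply (hproto L E A Z P P' (p o i) s' p s i v a b a' b' c); auto.
  - now rewrite <- comp_assoc, hs'.
  - exists d. split.
    + apply (pullback_eq hP).
      * apply himono.
        now rewrite (comp_assoc a), hd1, (comp_assoc i), hl, hc1, comp_idr.
      * now rewrite (comp_assoc b), hd2, hc2, comp_idr.
    + apply (pullback_eq hP').
      * now rewrite (comp_assoc a'), hc1, <- comp_assoc, hd1, hl, comp_idr.
      * now rewrite (comp_assoc b'), hc2, hd2, comp_idr. }
destruct hiso as [j [_ hj]].
rewrite <- (comp_idr (g o p)), <- (comp_idr (g o q)), <- hj, !comp_assoc.
now rewrite hi.
Qed.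

Lemma cokernel_exists (C : Category) (hC : Homological C) (K A : C) (k : Hom K A) :
  NormalMono k -> exists (Q : C) (q : Hom A Q), IsCokernel k q.
Proof.
intros [_ [B [f [hfk hker]]]].
destruct (image_exists (proj1 (proj2 hC)) f) as [M [m [hm [e [he hf]]]]].
exists M, e. apply (regepi_cokernel hC he).
subst f. split.
- apply (mono_zero hm). now rewrite comp_assoc.
- intros T t ht. apply hker. rewrite <- comp_assoc. now apply zero_comp_l.
Qed.

Lemma reflector_exists (C : Category) (hC : Homological C) (R : Radical C) :
  exists I : Reflector R, True.
Proof.
assert (ch : forall A : C, exists Qq : {Q : C & Hom A Q},
  IsCokernel (mu R A) (projT2 Qq)).
{ intros A. destruct (cokernel_exists hC (rad_normal R A)) as [Q [q hq]].
  now exists (existT _ Q q). }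
pose (Q A := projT1 (proj1_sig (constructive_indefinite_description _ (ch A)))).
pose (q A := projT2 (proj1_sig (constructive_indefinite_description _ (ch A)))
  : Hom A (Q A)).
assert (hq : forall A, IsCokernel (mu R A) (q A)).
{ intros A. exact (proj2_sig (constructive_indefinite_description _ (ch A))). }
assert (ex : forall (A B : C) (f : Hom A B), exists h : Hom (Q A) (Q B),
  h o q A = q B o f).
{ intros A B f. destruct (proj2 (hq A) _ (q B o f)) as [h [hh _]].
  - rewrite <- comp_assoc. pose proof (nt_nat (rad_mu R) f) as N; simpl in N.
    unfold mu. rewrite <- N, comp_assoc. apply zero_comp_r. apply (hq B).
  - now exists h. }
pose (F A B f := proj1_sig (constructive_indefinite_description _ (ex A B f))).
assert (hF : forall (A B : C) (f : Hom A B), F A B f o q A = q B o f).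
{ intros A B f. exact (proj2_sig (constructive_indefinite_description _ (ex A B f))). }
assert (epi : forall A, Epi (q A)).
{ intros A T u v huv. destruct (proj2 (hq A) T (v o q A)) as [w [_ hw]].
  - rewrite <- comp_assoc. apply zero_comp_l. apply (hq A).
  - now rewrite <- (hw u huv), <- (hw v eq_refl). }
unshelve refine (let G : Functor C (rad_sub R) := @MkFunctor C (rad_sub R)
  (fun A => exist _ (Q A) (rad_quotient (hq A))) F _ _ in _).
- intros A. apply (epi A). simpl. now rewrite hF, comp_idl, comp_idr.
- intros A B D g f. apply (epi A). simpl.
  now rewrite hF, <- comp_assoc, hF, !comp_assoc, hF.
- unshelve refine (let N : NatTrans (id_functor C) (comp_functor (rad_incl R) G) :=
    @MkNatTrans _ _ (id_functor C) (comp_functor (rad_incl R) G) q _ in _).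
  + intros A B f. simpl. now rewrite hF.
  + now exists (@MkReflector C R G N hq).
Qed.

Lemma reflector_universal (C : Category) (R : Radical C) (I : Reflector R) (A : C)
    (X : rad_sub R) (f : Hom A (rad_incl R X)) :
  exists! g : Hom (I A) X, fmap (rad_incl R) g o eta I A = f.
Proof.
apply (proj2 (reflector_cokernel I A)).
assert (N : mu R (rad_incl R X) o fmap R f = f o mu R A)
  by exact (nt_nat (rad_mu R) f).
rewrite <- N.
exists (R (rad_incl R X)), (fmap R f), (mu R (rad_incl R X)).
split; [exact (proj2_sig X)|reflexivity].
Qed.

(* Main.v *)
(* For a subobject [m] of [B] containing [R B], the composite [eta_B o m] is a
   regular epimorphism only if [m] is invertible: this is a short five lemma
   for the regular epimorphisms [eta_B o m] and [eta_B], which share the kernel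
   [R B].  Moreover [f] lies in [I^-1(RegEpi)] iff [eta_B o f] is a regular
   epimorphism iff [f] is orthogonal to the monomorphisms of the reflective
   subcategory.  Hence every [m] containing [R B] is right orthogonal to
   [I^-1(RegEpi)]: pull [m] back along the base of a square.  To factor
   [f : A -> B], take the inverse image along [eta_B] of the image of
   [eta_B o f]; its domain has the same radical as [B] by idempotence. *)

Require Import Defs.
Local Open Scope cat_scope.

Set Implicit Arguments.
Unset Strict Implicit.
Unset Printing Implicit Defensive.

(** * Regular epimorphisms *)

Lemma mono_split_epi_iso (C : Category) (A B : C) (m : Hom A B) (s : Hom B A) :
  Mono m -> m o s = idm B -> Iso m.
Proof.
intros hm hs. exists s. split; [|exact hs].
apply hm. now rewrite comp_assoc, hs, comp_idl, comp_idr.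
Qed.

Lemma pullback_mono (C : Category) (A B D P : C)
    (f : Hom A D) (g : Hom B D) (p : Hom P A) (q : Hom P B) :
  IsPullback f g p q -> Mono f -> Mono q.
Proof.
intros hP hf T u v huv. apply (pullback_eq hP); [|exact huv].
apply hf. now rewrite !comp_assoc, (proj1 hP), <- !comp_assoc, huv.
Qed.

(** Against a monomorphism, the upper triangle and the uniqueness of a diagonal are automatic, so
    only the lower triangle has to be produced. *)
Lemma orth_of_mono (C : Category) (A B D E : C) (e : Hom A B) (m : Hom D E) :
  Mono m ->
  (forall (alpha : Hom A D) (beta : Hom B E), beta o e = m o alpha ->
     SubLe beta m) ->
  Orth e m.
Proof.
intros hm h alpha beta hsq.
destruct (h _ _ hsq) as [delta hd].
exists delta. split.
- split; [exact hd|]. apply hm. now rewrite comp_assoc, hd.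
- intros d [hd' _]. apply hm. now rewrite hd, hd'.
Qed.

Lemma regepi_orth_mono (C : Category) (A B D E : C) (e : Hom A B) (m : Hom D E) :
  RegEpi e -> Mono m -> Orth e m.
Proof.
intros he hm. apply (orth_of_mono hm). intros alpha beta hsq.
assert (hepi := regepi_epi he).
destruct he as [K [a [b [hab hu]]]].
destruct (hu _ alpha) as [d [hd _]].
{ apply hm. now rewrite !comp_assoc, <- hsq, <- !comp_assoc, hab. }
exists d. apply hepi. now rewrite <- comp_assoc, hd.
Qed.

Lemma regepi_extremal (C : Category) (A B M : C)
    (f : Hom A B) (m : Hom M B) (g : Hom A M) :
  RegEpi f -> Mono m -> f = m o g -> Iso m.
Proof.
intros hf hm e.
destruct (regepi_orth_mono hf hm (alpha := g) (beta := idm B)) as [d [[hd _] _]].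
{ now rewrite comp_idl. }
exact (mono_split_epi_iso hm hd).
Qed.

Lemma regepi_iso_comp (C : Category) (A B D : C) (i : Hom B D) (f : Hom A B) :
  Iso i -> RegEpi f -> RegEpi (i o f).
Proof.
intros [j [hji hij]] [K [a [b [hab hu]]]].
exists K, a, b. split.
- now rewrite <- !comp_assoc, hab.
- intros T t ht. destruct (hu T t ht) as [h [hh huq]].
  exists (h o j). split.
  + now rewrite <- comp_assoc, (comp_assoc j), hji, comp_idl.
  + intros h' hh'. rewrite (huq (h' o i)).
    * now rewrite <- comp_assoc, hij, comp_idr.
    * now rewrite <- comp_assoc.
Qed.

(** The image monomorphism of [f] is invertible by hypothesis, so [f] is a regular epimorphism
    followed by an isomorphism. This criterion yields composition and cancellation of regular
    epimorphisms. *)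
Lemma extremal_regepi (C : Category) (hC : Regular C) (A B : C) (f : Hom A B) :
  (forall (M : C) (m : Hom M B) (g : Hom A M), Mono m -> f = m o g -> Iso m) ->
  RegEpi f.
Proof.
intros h. destruct (image_exists hC f) as [M [m [hm [e [he hf]]]]].
rewrite hf. exact (regepi_iso_comp (h _ _ _ hm hf) he).
Qed.

Lemma regepi_comp (C : Category) (hC : Regular C) (A B D : C)
    (g : Hom B D) (f : Hom A B) :
  RegEpi g -> RegEpi f -> RegEpi (g o f).
Proof.
intros hg hf. apply (extremal_regepi hC). intros M m h hm e.
destruct (regepi_orth_mono hf hm e) as [d [[hd _] _]].
exact (regepi_extremal hg hm (eq_sym hd)).
Qed.

Lemma regepi_cancel (C : Category) (hC : Regular C) (A B D : C)
    (g : Hom B D) (f : Hom A B) :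
  RegEpi (g o f) -> RegEpi g.
Proof.
intros h. apply (extremal_regepi hC). intros M m k hm e.
apply (regepi_extremal (g := k o f) h hm). now rewrite e, comp_assoc.
Qed.

Lemma split_epi_regepi (C : Category) (A B : C) (f : Hom A B) (s : Hom B A) :
  f o s = idm B -> RegEpi f.
Proof.
intros hs. exists A, (idm A), (s o f). split.
- now rewrite comp_assoc, hs, comp_idl, comp_idr.
- intros T t ht. exists (t o s). split.
  + now rewrite <- comp_assoc, <- ht, comp_idr.
  + intros h <-. now rewrite <- comp_assoc, hs, comp_idr.
Qed.

Lemma regepi_coequalizer_kernel_pair (C : Category) (A B K : C)
    (f : Hom A B) (p q : Hom K A) :
  RegEpi f -> IsPullback f f p q -> IsCoequalizer p q f.
Proof.
intros [L [a [b [hab hu]]]] [hpq hK]. split; [exact hpq|].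
intros T t ht. apply hu.
destruct (hK _ _ _ hab) as [w [[<- <-] _]].
now rewrite !comp_assoc, ht.
Qed.

(** * Zero morphisms and exactness *)

Lemma zero_mor_exists (C : Category) (hC : Pointed C) (A B : C) :
  exists z : Hom A B, ZeroMor z.
Proof.
destruct hC as [Z hZ].
destruct (proj2 hZ A) as [u _]. destruct (proj1 hZ B) as [v _].
exists (v o u), Z, u, v. now split.
Qed.

Lemma zero_mor_from_zero (C : Category) (A B : C) (f : Hom A B) :
  IsZero A -> ZeroMor f.
Proof. intros h. exists A, (idm A), f. now rewrite comp_idr. Qed.

Lemma zero_of_zero_id (C : Category) (A : C) : ZeroMor (idm A) -> IsZero A.
Proof.
intros [Z [u [v [hZ e]]]]. split; intros B.
- destruct (proj1 hZ B) as [w _]. exists (w o u). split; [trivial|].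
  intros f _. rewrite <- (comp_idr f), e, comp_assoc.
  now rewrite (initial_eq (f o v) w (proj1 hZ)).
- destruct (proj2 hZ B) as [w _]. exists (v o w). split; [trivial|].
  intros f _. rewrite <- (comp_idl f), e, <- comp_assoc.
  now rewrite (terminal_eq (u o f) w (proj2 hZ)).
Qed.

Lemma regepi_to_zero (C : Category) (A Z : C) (f : Hom A Z) : IsZero Z -> RegEpi f.
Proof.
intros hZ. destruct (proj1 hZ A) as [s _].
apply (split_epi_regepi (s := s)), (initial_eq _ _ (proj1 hZ)).
Qed.

(** [k] is a kernel of some [f], and [f] factors through [q]; whatever [q] kills is therefore killed
    by [f]. *)
Lemma kernel_of_cokernel (C : Category) (K A Q : C) (k : Hom K A) (q : Hom A Q) :
  NormalMono k -> IsCokernel k q -> IsKernel q k.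
Proof.
intros [_ [B [f [hfk hker]]]] [hqk hcok]. split; [exact hqk|].
intros T t ht. apply hker.
destruct (hcok _ f hfk) as [g [<- _]].
rewrite <- comp_assoc. now apply zero_comp_l.
Qed.

Lemma cokernel_regepi (C : Category) (hC : Pointed C) (K A Q : C)
    (k : Hom K A) (q : Hom A Q) :
  IsCokernel k q -> RegEpi q.
Proof.
intros [hqk hcok].
destruct (zero_mor_exists hC K A) as [z hz].
exists K, k, z. split.
- apply zero_eq; [exact hqk|now apply zero_comp_l].
- intros T t ht. apply hcok. rewrite ht. now apply zero_comp_l.
Qed.

(* Protomodularity only concerns split epimorphisms, so [l] is first pulled back
   along [q o l]: the points [L x_Q L] and [L x_Q B] over [L] have isomorphic
   kernels, hence [L x_Q B -> B], a pullback of [q o l], factors through [l]. *)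
Lemma short_five_mono (C : Category) (hC : Homological C) (K L B Q : C)
    (q : Hom B Q) (k : Hom K B) (l : Hom L B) :
  IsKernel q k -> Mono l -> SubLe k l -> RegEpi (q o l) -> Iso l.
Proof.
destruct hC as [[Z hZ] [[[hterm hpb] [hco hstab]] hproto]].
intros [hqk hker] hl [n hn] hql.
destruct (hpb _ _ _ (q o l) (q o l)) as [P1 [p1 [p2 hP1]]].
destruct (hpb _ _ _ (q o l) q) as [P2 [r1 [r2 hP2]]].
destruct (proj2 hP2 _ p1 (l o p2)) as [h [[hh1 hh2] _]].
{ rewrite comp_assoc. exact (proj1 hP1). }
destruct (proj2 hP1 _ (idm L) (idm L) eq_refl) as [s [[hs1 hs2] _]].
assert (hr1 : r1 o (h o s) = idm L) by now rewrite comp_assoc, hh1.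
(* [v] starts at the zero object, so [a] and [a'] below are kernels of [p1] and [r1]. *)
destruct (proj1 hZ L) as [v _].
destruct (hpb _ _ _ p1 v) as [P [a [b hP]]].
destruct (hpb _ _ _ r1 v) as [P' [a' [b' hP']]].
destruct (proj2 hP' _ (h o a) b) as [c [[hc1 hc2] _]].
{ rewrite comp_assoc, hh1. exact (proj1 hP). }
assert (hmono : Mono h).
{ intros T x y hxy. apply (pullback_eq hP1).
  - now rewrite <- hh1, <- !comp_assoc, hxy.
  - apply hl. now rewrite !comp_assoc, <- hh2, <- !comp_assoc, hxy. }
assert (hz : ZeroMor (q o (r2 o a'))).
{ rewrite comp_assoc, <- (proj1 hP2), <- comp_assoc, (proj1 hP').
  apply zero_comp_l. exists Z, b', v. now split. }
(* On the kernel of [r1], the component [r2] lands in the kernel of [q], hence in [l]; this factors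
   [a'] through [h]. *)
destruct (hker _ _ hz) as [t [ht _]].
destruct (proj2 hP1 _ (r1 o a') (n o t)) as [w [[hw1 hw2] _]].
{ rewrite <- (comp_assoc q l (n o t)), (comp_assoc l n), hn, ht.
  now rewrite !comp_assoc, (proj1 hP2). }
assert (hhw : h o w = a').
{ apply (pullback_eq hP2).
  - now rewrite comp_assoc, hh1.
  - now rewrite comp_assoc, hh2, <- comp_assoc, hw2, comp_assoc, hn. }
destruct (proj2 hP _ w b') as [d [[hd1 hd2] _]].
{ rewrite hw1. exact (proj1 hP'). }
assert (hiso : Iso h).
{ apply (hproto _ _ _ _ _ _ p1 s r1 (h o s) h v a b a' b' c); auto.
  exists d. split.
  - apply (pullback_eq hP).
    + apply hmono.
      now rewrite (comp_assoc a), hd1, comp_assoc, hhw, hc1, comp_idr.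
    + now rewrite (comp_assoc b), hd2, hc2, comp_idr.
  - apply (pullback_eq hP').
    + now rewrite (comp_assoc a'), hc1, <- comp_assoc, hd1, hhw, comp_idr.
    + now rewrite (comp_assoc b'), hc2, hd2, comp_idr. }
destruct hiso as [g [_ hg]].
apply (regepi_extremal (g := p2 o g) (hstab _ _ _ _ _ _ _ _ hP2 hql) hl).
now rewrite comp_assoc, <- hh2, <- comp_assoc, hg, comp_idr.
Qed.

Lemma iso_mono (C : Category) (A B : C) (f : Hom A B) : Iso f -> Mono f.
Proof.
intros [g [hg _]] T u v huv.
now rewrite <- (comp_idl u), <- (comp_idl v), <- hg, <- !comp_assoc, huv.
Qed.

Lemma mono_comp (C : Category) (A B D : C) (g : Hom B D) (f : Hom A B) :
  Mono g -> Mono f -> Mono (g o f).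
Proof. intros hg hf T u v huv. apply hf, hg. now rewrite !comp_assoc. Qed.

Lemma fmap_iso (C D : Category) (F : Functor C D) (A B : C) (f : Hom A B) :
  Iso f -> Iso (fmap F f).
Proof.
intros [g [h1 h2]]. exists (fmap F g).
now rewrite <- !fmap_comp, h1, h2, !fmap_id.
Qed.

(** * Radicals *)

Section Radical.

Variables (C : Category) (hC : Homological C) (R : Radical C) (I : Reflector R).

Let hpt : Pointed C := proj1 hC.
Let hreg : Regular C := proj1 (proj2 hC).

Lemma mu_nat (A B : C) (f : Hom A B) : mu R B o fmap R f = f o mu R A.
Proof. exact (nt_nat (rad_mu R) f). Qed.

Lemma eta_nat (A B : C) (f : Hom A B) :
  eta I B o f = fmap (rad_incl R) (fmap I f) o eta I A.
Proof. exact (nt_nat (reflector_unit I) f). Qed.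

Lemma mu_mono (A : C) : Mono (mu R A).
Proof. exact (proj1 (rad_normal R A)). Qed.

Lemma eta_mu_kernel (A : C) : IsKernel (eta I A) (mu R A).
Proof. exact (kernel_of_cokernel (rad_normal R A) (reflector_cokernel I A)). Qed.

Lemma eta_regepi (A : C) : RegEpi (eta I A).
Proof. exact (cokernel_regepi hpt (reflector_cokernel I A)). Qed.

(** * Closure properties of the reflective subcategory *)

Lemma rad_zero_of_mu (A : C) : ZeroMor (mu R A) -> IsZero (R A).
Proof.
intros h. apply zero_of_zero_id, (mono_zero (mu_mono (A := A))).
now rewrite comp_idr.
Qed.

Lemma comp_mu_zero (A X : C) (f : Hom A X) :
  IsZero (R X) -> ZeroMor (f o mu R A).
Proof.
intros hX. rewrite <- mu_nat.
now apply zero_comp_r, zero_mor_from_zero.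
Qed.

Lemma rad_zero_sub (A X : C) (m : Hom A X) :
  Mono m -> IsZero (R X) -> IsZero (R A).
Proof.
intros hm hX. apply rad_zero_of_mu, (mono_zero hm).
now apply comp_mu_zero.
Qed.

(** Both jointly monic projections kill [mu R P]. Consequently, kernel pairs of morphisms of the
    subcategory stay inside it. *)
Lemma rad_zero_pullback (A B D P : C)
    (f : Hom A D) (g : Hom B D) (p : Hom P A) (q : Hom P B) :
  IsPullback f g p q -> IsZero (R A) -> IsZero (R B) -> IsZero (R P).
Proof.
intros hP hA hB. apply rad_zero_of_mu.
destruct (zero_mor_exists hpt (R P) P) as [z hz].
replace (mu R P) with z; [exact hz|].
apply (pullback_eq hP); apply zero_eq;
  auto using zero_comp_l, comp_mu_zero.
Qed.

(** Test maps out of an arbitrary [T] extend along [eta I T], after which [m] can be cancelled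
    inside the subcategory. *)
Lemma rad_incl_mono (X Y : rad_sub R) (m : Hom X Y) :
  Mono m -> Mono (fmap (rad_incl R) m).
Proof.
intros hm T u v huv.
destruct (reflector_universal I u) as [u' [hu _]].
destruct (reflector_universal I v) as [v' [hv _]].
rewrite <- hu, <- hv in huv |- *.
f_equal. apply hm.
apply (regepi_epi (eta_regepi T)).
rewrite !comp_assoc in huv. exact huv.
Qed.

(** Forward: the image taken in [C] has zero radical, so its monomorphism is invertible by
    extremality of [f] in the subcategory. Backward: the kernel pair taken in [C] lies in the
    subcategory, and [f] is its coequalizer. *)
Lemma rad_incl_regepi (X Y : rad_sub R) (f : Hom X Y) :
  RegEpi f <-> RegEpi (fmap (rad_incl R) f).
Proof.
split; intros hf.
- destruct (image_exists hreg (fmap (rad_incl R) f)) as [M [m [hm [e [he hme]]]]].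
  pose (M' := exist _ M (rad_zero_sub hm (proj2_sig Y)) : rad_sub R).
  destruct (regepi_extremal (C := rad_sub R) (M := M') (m := m) (g := e) hf)
    as [j hj].
  + intros T u v huv. exact (hm _ u v huv).
  + exact hme.
  + rewrite hme. apply regepi_iso_comp; [|exact he]. exists j. exact hj.
- destruct (proj2 (proj1 hreg) _ _ _ (fmap (rad_incl R) f) (fmap (rad_incl R) f))
    as [K [p [q hK]]].
  destruct (regepi_coequalizer_kernel_pair hf hK) as [hpq hu].
  exists (exist _ K (rad_zero_pullback hK (proj2_sig X) (proj2_sig X)) : rad_sub R),
    p, q.
  split; [exact hpq|]. intros T t ht. exact (hu _ t ht).
Qed.

Lemma reflector_regepi (A B : C) (f : Hom A B) :
  RegEpi (fmap I f) <-> RegEpi (eta I B o f).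
Proof.
rewrite rad_incl_regepi, eta_nat. split; intros h.
- exact (regepi_comp hreg h (eta_regepi A)).
- exact (regepi_cancel hreg h).
Qed.

(** Forward: the base of a square extends along [eta I B], which gives a square on [eta I B o f].
    Backward: a monomorphism through which [eta I B o f] factors has its domain in the subcategory;
    lifting against it factors [eta I B] through it and makes it invertible. *)
Lemma eta_regepi_up (A B : C) (f : Hom A B) :
  RegEpi (eta I B o f) <->
  up (image_class (rad_incl R) (@Mono (rad_sub R))) f.
Proof.
split.
- intros hf D E n hn. destruct hn as [X Y n hn].
  assert (hm := rad_incl_mono hn).
  apply (orth_of_mono hm). intros alpha beta hsq.
  destruct (reflector_universal I beta) as [b [hb _]].
  destruct (regepi_orth_mono hf hm (alpha := alpha)
    (beta := fmap (rad_incl R) b)) as [d [[hd _] _]].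
  { now rewrite comp_assoc, hb. }
  exists (d o eta I B). now rewrite comp_assoc, hd.
- intros hf. apply (extremal_regepi hreg). intros M m g hm hmg.
  pose (M' := exist _ M (rad_zero_sub hm (proj2_sig (I B))) : rad_sub R).
  assert (hn : image_class (rad_incl R) (@Mono (rad_sub R)) m).
  { apply (@image_class_intro _ _ (rad_incl R) (@Mono (rad_sub R)) M' (I B) m).
    intros T u v huv. exact (hm _ u v huv). }
  destruct (hf _ _ _ hn _ _ hmg) as [d [[hd _] _]].
  exact (regepi_extremal (eta_regepi B) hm (eq_sym hd)).
Qed.

(** * Subobjects containing the radical *)

Lemma iso_of_mu_sub (A B : C) (m : Hom A B) :
  Mono m -> SubLe (mu R B) m -> RegEpi (eta I B o m) -> Iso m.
Proof. exact (short_five_mono hC (eta_mu_kernel B)). Qed.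

Lemma eta_regepi_orth (A B D E : C) (e : Hom A B) (m : Hom D E) :
  RegEpi (eta I B o e) -> Mono m -> SubLe (mu R E) m -> Orth e m.
Proof.
intros he hm [n hn]. apply (orth_of_mono hm). intros alpha beta hsq.
destruct (proj2 (proj1 hreg) _ _ _ m beta) as [P [p [i hP]]].
destruct (proj2 hP _ alpha e (eq_sym hsq)) as [g [[_ hg] _]].
(* [i] contains [R B] by naturality of [mu], and [e] factors through [i], so [eta I B o i] is a
   regular epimorphism by cancellation. *)
assert (hi : Iso i).
{ apply iso_of_mu_sub.
  - exact (pullback_mono hP hm).
  - destruct (proj2 hP _ (n o fmap R beta) (mu R B)) as [t [[_ ht] _]].
    { now rewrite comp_assoc, hn, mu_nat. }
    now exists t.
  - apply (regepi_cancel hreg (f := g)). now rewrite <- comp_assoc, hg. }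
destruct hi as [j [_ hj]]. exists (p o j).
now rewrite comp_assoc, (proj1 hP), <- comp_assoc, hj, comp_idr.
Qed.

(** Forward: a subobject containing both [h] and the radical is invertible by the short five
    argument. Backward: if [eta I B o h] factors through a monomorphism, the inverse image of the
    latter along [eta I B] contains both, hence is everything. *)
Lemma eta_regepi_sup (L B : C) (h : Hom L B) :
  RegEpi (eta I B o h) <-> IsSup h (mu R B) (idm B).
Proof.
split.
- intros hh. split; [|split; [|split]].
  + intros T u v. now rewrite !comp_idl.
  + exists h. apply comp_idl.
  + exists (mu R B). apply comp_idl.
  + intros M m hm [g hg] hmu.
    destruct (iso_of_mu_sub hm hmu) as [j [_ hj]].
    { apply (regepi_cancel hreg (f := g)). now rewrite <- comp_assoc, hg. }
    now exists j.
- intros [_ [_ [_ hsup]]].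
  apply (extremal_regepi hreg). intros M m g hm hmg.
  destruct (proj2 (proj1 hreg) _ _ _ m (eta I B)) as [P [p [i hP]]].
  destruct (hsup _ i (pullback_mono hP hm)) as [s hs].
  + destruct (proj2 hP _ g h (eq_sym hmg)) as [t [[_ ht] _]]. now exists t.
  + destruct (zero_mor_exists hpt (R B) M) as [z hz].
    destruct (proj2 hP _ z (mu R B)) as [t [[_ ht] _]].
    { apply zero_eq; [now apply zero_comp_l|apply (eta_mu_kernel B)]. }
    now exists t.
  + apply (regepi_extremal (g := p o s) (eta_regepi B) hm).
    now rewrite comp_assoc, (proj1 hP), <- comp_assoc, hs, comp_idr.
Qed.

Lemma eta_regepi_image (A B L : C) (f : Hom A B) (im : Hom L B) :
  IsImage f im -> (RegEpi (eta I B o f) <-> IsSup im (mu R B) (idm B)).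
Proof.
intros [_ [e [he ->]]]. rewrite <- eta_regepi_sup, comp_assoc. split; intros h.
- exact (regepi_cancel hreg h).
- exact (regepi_comp hreg h he).
Qed.

Lemma eta_regepi_closed_iso :
  ClosedUnderIso (fun (A B : C) (f : Hom A B) => RegEpi (eta I B o f)).
Proof.
split.
- intros A B D f i hf hi. rewrite comp_assoc, eta_nat, <- comp_assoc.
  apply regepi_iso_comp; [|exact hf].
  now apply fmap_iso, fmap_iso.
- intros A B D i f [j [_ hj]] hf. rewrite comp_assoc.
  exact (regepi_comp hreg hf (split_epi_regepi hj)).
Qed.

Lemma mono_mu_closed_iso :
  ClosedUnderIso (fun (A B : C) (m : Hom A B) => Mono m /\ SubLe (mu R B) m).
Proof.
split.
- intros A B D m i [hm [n hn]] hi.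
  split; [exact (mono_comp (iso_mono hi) hm)|].
  destruct hi as [j [_ hj]]. exists (n o fmap R j).
  now rewrite comp_assoc, <- (comp_assoc i), hn, <- comp_assoc, mu_nat,
    comp_assoc, hj, comp_idl.
- intros A B D i m hi [hm [n hn]].
  split; [exact (mono_comp hm (iso_mono hi))|].
  destruct hi as [j [_ hj]]. exists (j o n).
  now rewrite <- comp_assoc, (comp_assoc i), hj, comp_idl.
Qed.

(** * Consequences of idempotence *)

Hypothesis hR : Idempotent R.

Lemma mu_rad_iso (A : C) : Iso (mu R (R A)).
Proof.
replace (mu R (R A)) with (fmap R (mu R A)); [apply hR|].
apply (mu_mono (A := A)), mu_nat.
Qed.

(** The unit at [R A] kills the isomorphism [mu R (R A)], so it is both zero and an epimorphism. *)
Lemma eta_rad_zero (A : C) : IsZero (rad_incl R (I (R A))).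
Proof.
destruct (mu_rad_iso A) as [j [_ hj]].
apply zero_of_zero_id.
assert (h : ZeroMor (eta I (R A))).
{ rewrite <- (comp_idr (eta I (R A))), <- hj, comp_assoc.
  apply zero_comp_r, (eta_mu_kernel (R A)). }
destruct (zero_mor_exists hpt (rad_incl R (I (R A))) (rad_incl R (I (R A))))
  as [z hz].
replace (idm (rad_incl R (I (R A)))) with z; [exact hz|].
apply (regepi_epi (eta_regepi (R A))).
apply zero_eq; [now apply zero_comp_r|now rewrite comp_idl].
Qed.

Lemma eta_regepi_mu_factorization (A B : C) (f : Hom A B) :
  exists (D : C) (e : Hom A D) (m : Hom D B),
    RegEpi (eta I D o e) /\ (Mono m /\ SubLe (mu R B) m) /\ f = m o e.
Proof.
destruct (image_exists hreg (eta I B o f)) as [N [n [hn [e' [he' hf]]]]].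
destruct (proj2 (proj1 hreg) _ _ _ (eta I B) n) as [D [m [q hD]]].
assert (hm : Mono m).
{ intros T u v huv. apply (pullback_eq hD); [exact huv|].
  apply hn. now rewrite !comp_assoc, <- (proj1 hD), <- !comp_assoc, huv. }
destruct (proj2 hD _ f e' hf) as [e [[he1 he2] _]].
destruct (zero_mor_exists hpt (R B) N) as [z hz].
destruct (proj2 hD _ (mu R B) z) as [k [[hk1 hk2] _]].
{ apply zero_eq; [apply (eta_mu_kernel B)|now apply zero_comp_l]. }
(* [k] embeds [R B] in [D]; once it is the kernel of the regular epimorphism [q], [q] is its
   cokernel. *)
assert (hker : IsKernel q k).
{ split; [now rewrite hk2|]. intros T t ht.
  destruct (proj2 (eta_mu_kernel B) _ (m o t)) as [h [hh hu]].
  { rewrite comp_assoc, (proj1 hD), <- comp_assoc. now apply zero_comp_l. }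
  exists h. split.
  - apply hm. now rewrite comp_assoc, hk1.
  - intros h' <-. apply hu. now rewrite comp_assoc, hk1. }
assert (hq : RegEpi q) by exact (proj2 (proj2 hreg) _ _ _ _ _ _ _ _ hD (eta_regepi B)).
(* By naturality [eta I D o k] passes through the zero object [I (R B)]. Hence [eta I D = t o q]
   with [t] a regular epimorphism, and [eta I D o e = t o e']. *)
assert (hz' : ZeroMor (eta I D o k)).
{ rewrite eta_nat. now apply zero_comp_r, zero_mor_from_zero, eta_rad_zero. }
destruct (proj2 (regepi_cokernel hC hq hker) _ _ hz') as [t [ht _]].
exists D, e, m. repeat split.
- rewrite <- ht, <- comp_assoc, he2. apply (regepi_comp hreg); [|exact he'].
  apply (regepi_cancel hreg (f := q)). rewrite ht. apply eta_regepi.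
- exact hm.
- now exists k.
- now symmetry.
Qed.

(** The regular epimorphism [e] of the image factorization [m = n o e] belongs to the left class, so
    it lifts against [m] itself; the square with top the identity and base [n] provides a retraction
    of [e]. *)
Lemma down_mono (A B : C) (m : Hom A B) :
  down (fun (A B : C) (f : Hom A B) => RegEpi (eta I B o f)) m -> Mono m.
Proof.
intros h. destruct (image_exists hreg m) as [M [n [hn [e [he ->]]]]].
assert (horth : Orth e (n o e)) by exact (h _ _ _ (regepi_comp hreg (eta_regepi _) he)).
destruct (horth (idm A) n) as [d [[_ hd] _]]; [now rewrite comp_idr|].
apply (mono_comp hn).
intros T u v huv.
now rewrite <- (comp_idl u), <- (comp_idl v), <- hd, <- !comp_assoc, huv.
Qed.

Lemma sub_le_of_down (A B D P : C) (m : Hom A B) (d : Hom D B)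
    (p : Hom P A) (i : Hom P D) :
  down (fun (A B : C) (f : Hom A B) => RegEpi (eta I B o f)) m ->
  IsPullback m d p i -> RegEpi (eta I D o i) -> SubLe d m.
Proof.
intros hm hP hi.
destruct (hm _ _ _ hi _ _ (eq_sym (proj1 hP))) as [s [[hs _] _]].
now exists s.
Qed.

(** The hypothesis is applied to [mu R B]: its unit has zero codomain by idempotence, and every
    morphism to a zero object is a regular epimorphism. *)
Lemma mu_sub_of_dense_sub (A B : C) (m : Hom A B) :
  (forall (D : C) (d : Hom D B), Mono d ->
   forall (P : C) (p : Hom P A) (i : Hom P D), IsPullback m d p i ->
     RegEpi (eta I D o i) -> SubLe d m) ->
  SubLe (mu R B) m.
Proof.
intros h.
destruct (proj2 (proj1 hreg) _ _ _ m (mu R B)) as [P [p [i hP]]].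
apply (h _ _ (mu_mono (A := B)) _ _ _ hP).
apply regepi_to_zero, eta_rad_zero.
Qed.

End Radical.

(** * The factorization system *)

Lemma same_class_down (C : Category) (N N' : MorClass C) :
  SameClass N N' -> SameClass (down N) (down N').
Proof. intros h A B f. split; intros hf D E n hn; apply hf, h, hn. Qed.

Lemma closed_iso_same_class (C : Category) (N N' : MorClass C) :
  SameClass N N' -> ClosedUnderIso N' -> ClosedUnderIso N.
Proof.
intros h [h1 h2]. split.
- intros A B D f i hf hi. apply h, h1; [apply h, hf|exact hi].
- intros A B D i f hi hf. apply h, h2; [exact hi|apply h, hf].
Qed.

Theorem theorem4p9 :
  forall (C : Category) (hC : Homological C)
         (R : Radical C) (hR : Idempotent R) (I : Reflector R),
  let E : MorClass C := preimage_class I (@RegEpi (rad_sub R)) in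
  let M : MorClass C := down (up (image_class (rad_incl R) (@Mono (rad_sub R)))) in
  FactorizationSystem E M /\
  (SameClass E (fun (A B : C) (f : Hom A B) => RegEpi (eta I B o f)) /\
   (forall (A B L : C) (f : Hom A B) (im : Hom L B),
      IsImage f im -> NormalMono im ->
      (E A B f <-> IsSup im (mu R B) (idm B))) /\
   (Abelian C ->
    forall (A B L : C) (f : Hom A B) (im : Hom L B),
      IsImage f im ->
      NormalMono im /\ (E A B f <-> IsSup im (mu R B) (idm B)))) /\
  (forall (A B : C) (m : Hom A B),
     (M A B m <-> (Mono m /\ SubLe (mu R B) m)) /\
     (M A B m <->
        (Mono m /\
         forall (D : C) (d : Hom D B), Mono d ->
         forall (P : C) (p : Hom P A) (i : Hom P D), IsPullback m d p i ->
           RegEpi (eta I D o i) -> SubLe d m))).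
Proof.
intros C hC R hR I E M.
assert (hE : SameClass E (fun A B f => RegEpi (eta I B o f)))
  by exact (reflector_regepi hC I).
assert (hdown : SameClass M (down (fun A B f => RegEpi (eta I B o f)))).
{ apply same_class_down. intros A B f. symmetry. apply (eta_regepi_up hC I). }
(* The three descriptions of [M] are linked in a cycle: membership gives the density condition,
   which gives containment of the radical, which gives orthogonality to the left class. *)
assert (hM3 : forall (A B : C) (m : Hom A B), M A B m -> Mono m /\
  forall (D : C) (d : Hom D B), Mono d ->
  forall (P : C) (p : Hom P A) (i : Hom P D), IsPullback m d p i ->
    RegEpi (eta I D o i) -> SubLe d m).
{ intros A B m hm. apply hdown in hm. split; [exact (down_mono hC hm)|].
  intros D d _ P p i. exact (sub_le_of_down hm). }
assert (hM : SameClass M (fun A B m => Mono m /\ SubLe (mu R B) m)).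
{ intros A B m. split.
  - intros hm. apply hM3 in hm. destruct hm as [hm h]. split; [exact hm|].
    exact (mu_sub_of_dense_sub hC hR h).
  - intros [hm hmu]. apply hdown. intros D F e he.
    exact (eta_regepi_orth hC he hm hmu). }
assert (himage : forall (A B L : C) (f : Hom A B) (im : Hom L B),
  IsImage f im -> (E A B f <-> IsSup im (mu R B) (idm B))).
{ intros A B L f im him. rewrite (hE A B f). exact (eta_regepi_image hC I him). }
split; [|split; [split; [exact hE|split]|]].
- split; [exact (closed_iso_same_class hE (eta_regepi_closed_iso hC I))|].
  split; [exact (closed_iso_same_class hM (mono_mu_closed_iso R))|].
  split.
  + intros A B f.
    destruct (eta_regepi_mu_factorization hC I hR f) as [D [e [m [he [hm hf]]]]].
    exists D, e, m. split; [now apply hE|]. split; [now apply hM|exact hf].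
  + intros A B D F e m he hm. apply hE in he. apply hM in hm.
    exact (eta_regepi_orth hC he (proj1 hm) (proj2 hm)).
- intros A B L f im him _. exact (himage _ _ _ _ _ him).
- intros hab A B L f im him. split; [|exact (himage _ _ _ _ _ him)].
  destruct hab as [_ [_ [_ [_ [_ [hnormal _]]]]]].
  split; [exact (proj1 him)|exact (hnormal _ _ _ (proj1 him))].
- intros A B m. split; [exact (hM A B m)|]. split; [exact (hM3 A B m)|].
  intros [hm h]. apply hM. split; [exact hm|].
  exact (mu_sub_of_dense_sub hC hR h).
Qed.
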